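(* Let $k,\ell$ be positive integers with $\ell$ odd, and let $\alpha, A, \beta_2,\beta_4,\dots,\beta_{2k}$ be nonnegative real numbers. Consider the rational difference equation $$x_n=\frac{\alpha+\sum_{i=1}^{k}\beta_{2i}x_{n-2i}+x_{n-\ell}}{A+x_{n-\ell}},\quad n\in\mathbb{N},$$ with positive initial conditions. Then the solutions exhibit the following trichotomy behavior. (i) When $A+1>\sum_{i=1}^{k}\beta_{2i}$, every solution converges to an equilibrium. (ii) When $A+1=\sum_{i=1}^{k}\beta_{2i}$, every solution converges to a periodic solution of not necessarily prime period $2\gcd(I_\beta)$, and there exist periodic solutions of prime period $2\gcd(I_\beta)$. (iii) When $A+1<\sum_{i=1}^{k}\beta_{2i}$, unbounded solutions exist for some choice of (positive) initial conditions.
   Context: $\mathbb{N}=\{1,2,3,\dots\}$. With $K=\max(2k,\ell)$, the initial conditions are $x_{1-K},\dots,x_0$, and a solution is the sequence $(x_n)_{n\ge 1-K}$ generated from them by the recursion; positive initial conditions means all of these values are strictly positive. $I_\beta$ is the set of positive integers $j$ such that the coefficient of $x_{n-j}$ in the numerator is positive. Since $x_{n-\ell}$ appears in the numerator with coefficient $1$, this means $I_\beta=\{2i : 1\le i\le k,\ \beta_{2i}>0\}\cup\{\ell\}$. An equilibrium is a constant solution of the equation. A periodic solution of not necessarily prime period $p$ is a solution with $x_{n+p}=x_n$ for all $n$; it has prime period $p$ if $p$ is the least positive integer with this property. A solution $(x_n)$ converges to a periodic solution $(y_n)$ if $x_n-y_n\to 0$ as $n\to\infty$. *)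

(* Defs.v *)
From HB Require Import structures.
From mathcomp Require Import all_boot all_order all_algebra.
From mathcomp Require Import all_classical all_reals all_analysis.

Set Implicit Arguments.
Unset Strict Implicit.
Unset Printing Implicit Defensive.

Import Order.TTheory GRing.Theory Num.Theory.
Import numFieldNormedType.Exports.

Local Open Scope classical_set_scope.
Local Open Scope ring_scope.

(* The equation
     x_n = (alpha + sum_(1 <= i <= k) beta_(2i) x_(n-2i) + x_(n-l))
           / (A + x_(n-l)),  n >= 1,
   has order K = max(2k, l) and its solutions are indexed by n >= 1 - K.
   A solution is represented by x : nat -> R, where x m stands for
   x_(m + 1 - K): the initial conditions are x 0, ..., x (K - 1) and the
   recursion holds at every m >= K.  Of beta : nat -> R only the values at
   2, 4, ..., 2k are ever used. *)

Definition delay (k l : nat) : nat := maxn (2 * k) l.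

(* Since K <= m, none of the subtractions below is truncated.  The nonzero
   denominator is demanded explicitly because division is total. *)
Definition is_solution (R : realType) (k l : nat) (alpha A : R)
    (beta : nat -> R) (x : nat -> R) : Prop :=
  forall m : nat, (delay k l <= m)%N ->
    A + x (m - l)%N != 0 /\
    x m = (alpha + \sum_(1 <= i < k.+1) beta (2 * i)%N * x (m - 2 * i)%N
           + x (m - l)%N) / (A + x (m - l)%N).

Definition is_positive_solution (R : realType) (k l : nat) (alpha A : R)
    (beta : nat -> R) (x : nat -> R) : Prop :=
  (forall m : nat, (m < delay k l)%N -> 0 < x m) /\
  is_solution k l alpha A beta x.

(* Positivity is not required: for alpha = 0 < A, 0 is an equilibrium, and
   it can be the limit of positive solutions. *)
Definition is_equilibrium (R : realType) (k l : nat) (alpha A : R)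
    (beta : nat -> R) (c : R) : Prop :=
  is_solution k l alpha A beta (fun=> c).

Definition has_period (R : realType) (x : nat -> R) (p : nat) : Prop :=
  forall m : nat, x (m + p)%N = x m.

Definition has_prime_period (R : realType) (x : nat -> R) (p : nat) : Prop :=
  [/\ (0 < p)%N, has_period x p &
      forall q : nat, (0 < q)%N -> has_period x q -> (p <= q)%N].

Definition I_beta (R : realType) (k l : nat) (beta : nat -> R) : seq nat :=
  l :: [seq (2 * i)%N | i <- iota 1 k & 0 < beta (2 * i)%N].

Definition gcd_I_beta (R : realType) (k l : nat) (beta : nat -> R) : nat :=
  \big[gcdn/0%N]_(j <- I_beta k l beta) j.

(* Main.v *)
Require Import Defs.
From HB Require Import structures.
From mathcomp Require Import all_boot all_order all_algebra.
From mathcomp Require Import all_classical all_reals all_analysis.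
From mathcomp Require Import zify ring lra.

Set Implicit Arguments.
Unset Strict Implicit.
Unset Printing Implicit Defensive.

Import Order.TTheory GRing.Theory Num.Theory.
Import numFieldNormedType.Exports.

Local Open Scope classical_set_scope.
Local Open Scope ring_scope.

(** Write [B] for the sum of the weights [beta (2 * i)] and [K] for the order
of the equation. The excess [y = x - 1] of a solution over [1] satisfies
[[
  y n * (A + 1 + y (n - l)) = alpha + B - A + \sum_i beta (2i) * y (n - 2i),
]]
and everything depends on the sign of the constant [alpha + B - A].

If [alpha + B <= A], which can only happen in case (i), the equation is
monotone near its largest equilibrium [c <= 1]: the deviation [x - c] is a
combination of earlier deviations with nonnegative coefficients, and
[converges_below] turns this into a contraction.

If [A < alpha + B], the lower bound of a window of length [K] grows
geometrically until it reaches [1], so that eventually [x > 1]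
([eventually_gt1]). From then on [y > 0]. Put [kap = A + 1 - B].
When [kap >= 0], pick the [c > 0] with [c * c + kap * c = alpha + B - A].
The delays [2i] preserve the parity of the index while the odd delay [l]
reverses it; hence the change of variable [flip], [w n = y n] for even [n] and
[w n = c * c / y n] for odd [n], straightens the recursion: [w n] becomes a
convex combination of [c], with weight proportional to [kap], and of the
[w (n - d)] for [d] in [I_beta], with weights bounded away from [0]
([flip_convex]).

In case (i) [kap > 0], so the pull towards [c] makes the distance to [c]
contract and [w] tends to [c], hence so does [y].

In case (ii) [kap = 0] and [w] is a pure averaging of its own past. Since
every large multiple of [g = gcd I_beta] is a sum of delays
([multiples_of_gcd]), a high value at [n] raises all values at
[n + T], [n + T + g], and so on; the oscillation along each progression of
step [g] therefore decays geometrically and [w] approaches a sequence of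
period [g]. Flipping back, and because [g] is odd, [y] approaches a sequence of
period [2 * g]. Conversely every positive [g]-periodic sequence, flipped,
solves the equation ([flip_solution]), which also produces a solution of prime
period [2 * g].

In case (iii) start with small excesses at odd indices and large ones at even
indices. The small ones stay small because they are divided by large ones, and
then the large ones are multiplied by a factor at least
[B / (A + 1 + eta) > 1] over each window, so the solution is unbounded.

Apart from case (ii), every limit is reached through one principle
([eventually_le_of_contraction]): a quantity which, above the level [e], is
at most [t < 1] times its maximum over the last [K] steps eventually falls
to [e] or below. *)

(** * Sequences controlled by a sliding window *)

Lemma cvg_of_eventually_le (R : realType) (u : nat -> R) (v : R) :
    (forall e : R, 0 < e ->
      exists N : nat, forall n, (N <= n)%N -> `|u n - v| <= e) ->
  u n @[n --> \oo] --> v.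
Proof.
move=> H; apply/cvgrPdist_le => e e0; have [N HN] := H e e0.
by exists N => // n /= Nn; rewrite distrC; exact: HN.
Qed.

(** This is the larger root of [c ^+ 2 + p * c = q]; the second conclusion,
that the other root [- (c + p)] is nonpositive, is what later controls the
denominators. *)
Lemma quadratic_root (R : realType) (p q : R) : 0 <= q ->
  exists c : R, [/\ 0 <= c, 0 <= c + p & c * c + p * c = q].
Proof.
move=> q0; set s := Num.sqrt (p ^+ 2 + 4 * q).
have s2 : s ^+ 2 = p ^+ 2 + 4 * q by rewrite sqr_sqrtr //; nra.
have s0 : 0 <= s by exact: sqrtr_ge0.
have sp : `|p| <= s by rewrite -sqrtr_sqr ler_wsqrtr //; lra.
have := ler_norm p; have := ler_norm (- p); rewrite normrN => p1 p2.
by exists ((s - p) / 2); split; [lra|lra|nra].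
Qed.

Lemma initial_bound (R : realType) (z : nat -> R) (L : nat) (e : R) :
  exists2 M, e <= M & forall n, (n < L)%N -> z n <= M.
Proof.
elim: L => [|L [M eM HM]]; first by exists e.
exists (Num.max M (z L)) => [|n]; first by rewrite le_max eM.
rewrite ltnS leq_eqVlt => /orP[/eqP->|/HM nM]; rewrite le_max ?lexx ?orbT //.
by rewrite nM.
Qed.

Lemma geometric_eventually_le (R : realType) (t M e : R) :
  0 <= t < 1 -> 0 < e -> exists j : nat, t ^+ j * M <= e.
Proof.
move=> /andP[t0 t1] e0.
have M1 : 0 < `|M| + 1 by rewrite ltr_wpDl.
have ct : (fun j : nat => t ^+ j) @ \oo --> (0 : R).
  by apply: cvg_expr; rewrite ger0_norm.
have /cvgrPdist_le /(_ (e / (`|M| + 1))) := ct.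
rewrite divr_gt0 // => /(_ isT)[j _ /(_ j (leqnn j))] /=.
rewrite sub0r normrN ger0_norm ?exprn_ge0 // ler_pdivlMr // => H.
exists j; apply: le_trans H; rewrite ler_wpM2l ?exprn_ge0 //.
by rewrite (le_trans (ler_norm M)) // lerDl.
Qed.

(** The bound [M] on a window is arbitrary, so the hypothesis can be iterated:
after [j] windows the values are at most [e] or [t ^+ j] times the initial
bound, and the second alternative drops below [e] as well. The hypothesis is
asked only for [M] above [e], which lets [t] depend on [e] and covers limits
approached at less than geometric speed. *)
Lemma eventually_le_of_contraction (R : realType) (z : nat -> R)
    (N K : nat) (e t : R) :
    (0 < K)%N -> 0 < e -> t < 1 ->
    (forall (n : nat) (M : R), (N + K <= n)%N -> e <= M ->
       (forall d : nat, (0 < d <= K)%N -> z (n - d)%N <= M) ->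
       z n <= Num.max e (t * M)) ->
  exists N' : nat, forall n, (N' <= n)%N -> z n <= e.
Proof.
move=> K0 e0 t1 H.
have [M eM HM] := initial_bound z (N + K) e.
(* A negative [t] would spoil the powers of [t]; enlarging it is harmless. *)
pose s := Num.max 0 t.
have s0 : 0 <= s by rewrite le_max lexx.
have s1 : s < 1 by rewrite gt_max ltr01.
have ts : t <= s by rewrite le_max lexx orbT.
have M0 : 0 <= M by apply: le_trans eM; exact: ltW.
have Hs (n : nat) (M' : R) : (N + K <= n)%N -> e <= M' ->
       (forall d : nat, (0 < d <= K)%N -> z (n - d)%N <= M') ->
       z n <= Num.max e (s * M').
  move=> Nn eM' /(H _ _ Nn eM') /le_trans; apply.
  rewrite ge_max le_max lexx /= le_max; apply/orP; right.
  by apply: ler_wpM2r => //; apply: le_trans eM'; exact: ltW.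
have bound (n : nat) : z n <= M.
  elim/ltn_ind: n => n IH.
  have [/HM//|Nn] := ltnP n (N + K).
  apply: le_trans (Hs n M Nn eM _) _ => [d /andP[d0 dK]|].
    by apply: IH; lia.
  by rewrite ge_max eM /= ler_piMl // ltW.
have claim (j : nat) : forall n, (N + j * K <= n)%N -> z n <= Num.max e (s ^+ j * M).
  elim: j => [|j IH] n; first by rewrite expr0 mul1r le_max bound orbT.
  rewrite mulSn => Nn.
  apply: le_trans (Hs n (Num.max e (s ^+ j * M)) _ _ _) _.
  - by lia.
  - by rewrite le_max lexx.
  - by move=> d /andP[d0 dK]; apply: IH; lia.
  rewrite ge_max le_max lexx /= maxr_pMr // ge_max.
  rewrite le_max ler_piMl ?(ltW e0) ?(ltW s1) //=.
  by rewrite le_max exprS mulrA lexx orbT.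
have s01 : 0 <= s < 1 by rewrite s0.
have [j Hj] := geometric_eventually_le M s01 e0.
by exists (N + j * K)%N => n /claim /le_trans; apply; rewrite ge_max lexx Hj.
Qed.

(** Recursion on the whole past: the values are computed as a growing list,
since [F n] reads only the entries below [n]. *)
Lemma course_of_values (R : realType) (F : nat -> (nat -> R) -> R) :
    (forall n u v, (forall i, (i < n)%N -> u i = v i) -> F n u = F n v) ->
  exists x : nat -> R, forall n, x n = F n x.
Proof.
move=> HF.
pose s := fix s n := if n is m.+1 then rcons (s m) (F m (nth 0 (s m))) else [::].
have size_s n : size (s n) = n by elim: n => //= n IH; rewrite size_rcons IH.
have nth_s n i : (i < n)%N -> nth 0 (s n) i = nth 0 (s i.+1) i.
  elim: n => // n IH; rewrite ltnS leq_eqVlt => /orP[/eqP->//|lin].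
  by rewrite [s n.+1]/= nth_rcons size_s lin IH.
exists (fun n => nth 0 (s n.+1) n) => n.
rewrite /= nth_rcons size_s ltnn eqxx; apply: HF => i lin; exact: nth_s.
Qed.

(** * Averaging recursions and the gcd of their delays *)

(** Large multiples of the gcd of [D] are sums of elements of [D]; [P] is any
property that passes from [t] to [t + d]. Adding a generator [d] to
generators of gcd [g], a Bezout relation gives for each multiple [t] of
[gcdn d g] some [x <= g] with [g %| t - x * d], and [t - x * d] is a
large multiple of [g] when [t] is large enough. *)
Lemma multiples_of_gcd (D : seq nat) :
  exists N : nat, forall P : nat -> Prop, P 0%N ->
    (forall d t, d \in D -> P t -> P (t + d)%N) ->
    forall t, (N <= t)%N -> (\big[gcdn/0%N]_(d <- D) d %| t)%N -> P t.
Proof.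
elim: D => [|d D [N IH]].
  by exists 0%N => P P0 _ t _; rewrite big_nil dvd0n => /eqP->.
set g := \big[gcdn/0%N]_(d <- D) d in IH.
exists (N + g * d)%N => P P0 Pstep t Nt; rewrite big_cons -/g => gt.
have Piter x t' : P t' -> P (t' + x * d)%N.
  move=> Pt'; elim: x => [|x IHx]; first by rewrite mul0n addn0.
  by rewrite mulSn addnA addnAC; apply: Pstep; rewrite // mem_head.
have Pg t' : (N <= t')%N -> (g %| t')%N -> P t'.
  by apply: IH => // d' t'' dD; apply: Pstep; rewrite inE dD orbT.
have [g0|g0] := posnP g.
  move: gt; rewrite g0 gcdn0 => /dvdnP[q ->].
  by rewrite -[(q * d)%N]add0n; exact: Piter.
have [a _ ga] := Bezoutr d g0.
have /dvdnP[q tE] := gt.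
pose x := (g - (a * q) %% g)%N.
have xg : (x <= g)%N by exact: leq_subr.
have gx : (g %| x + a * q)%N.
  rewrite [X in (x + X)%N](divn_eq (a * q) g) addnCA /x dvdn_addr ?dvdn_mull //.
  by rewrite subnK // ltnW // ltn_mod.
have xt : (x * d <= t)%N.
  by apply: leq_trans Nt; apply: leq_trans (leq_addl _ _); rewrite leq_mul2r xg orbT.
rewrite -(subnK xt); apply: Piter; apply: Pg.
  by rewrite leq_subRL //; apply: leq_trans Nt; rewrite addnC leq_add2l leq_mul2r xg orbT.
rewrite -(@dvdn_addl ((x + a * q) * d) g) ?dvdn_mulr //.
have -> : (t - x * d + (x + a * q) * d = q * (gcdn d g + a * d))%N.
  by rewrite {1}tE mulnDl mulnDr addnA subnK -?tE //; lia.
by rewrite dvdn_mull.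
Qed.

Section AveragingRecursions.
Context (R : realType).

(** The one-sided content of being an average with weights at least [e] on every
delay; the other side is the same property of the opposite sequence. *)
Definition pulls_up (D : seq nat) (N : nat) (e : R) (w : nat -> R) : Prop :=
  forall (n : nat) (a : R), (N <= n)%N ->
    (forall d, d \in D -> a <= w (n - d)%N) ->
    forall d, d \in D -> e * (w (n - d)%N - a) <= w n - a.

Variables (D : seq nat) (K N : nat) (e : R).
Hypothesis D_neq0 : D != [::].
Hypothesis D_range : forall d, d \in D -> (0 < d <= K)%N.
Hypothesis KN : (K <= N)%N.
Hypothesis e_gt0 : 0 < e.
Hypothesis e_le1 : e <= 1.

Let g := \big[gcdn/0%N]_(d <- D) d.

Lemma gcd_dvd d : d \in D -> (g %| d)%N.
Proof. by move=> dD; rewrite /g (big_rem d) //= dvdn_gcdl. Qed.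

Lemma gcd_delays_gt0 : (0 < g)%N.
Proof.
have [d dD] : exists d, d \in D.
  by case: D D_neq0 => // d D' _; exists d; rewrite mem_head.
have /andP[d0 _] := D_range dD; have := gcd_dvd dD.
by case: (g) => //; rewrite dvd0n; case: d d0 {dD}.
Qed.

(** Every delay is a multiple of [g], so the progressions of step [g] do not
interact and a bound on one window of a single progression persists. *)
Lemma lower_bound_propagates (w : nat -> R) (n : nat) (a : R) :
    pulls_up D N e w -> (N <= n + K)%N ->
    (forall m, (g * m < K)%N -> a <= w (n + g * m)%N) ->
  forall m, a <= w (n + g * m)%N.
Proof.
move=> Hw Nn Ha; elim/ltn_ind=> m IH.
have [/Ha//|Km] := ltnP (g * m) K.
have Ha' d : d \in D -> a <= w (n + g * m - d)%N.
  move=> dD; have /andP[d0 dK] := D_range dD.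
  have /dvdnP[q dE] := gcd_dvd dD.
  have q0 : (0 < q)%N by case: q dE d0 => // ->.
  have qm : (q <= m)%N.
    by rewrite -(leq_pmul2l gcd_delays_gt0) [(g * q)%N]mulnC -dE (leq_trans dK).
  have -> : (n + g * m - d = n + g * (m - q))%N.
    by rewrite mulnBr dE [(q * g)%N]mulnC addnBA // leq_mul2l qm orbT.
  by apply: IH; rewrite ltn_subrL q0 (leq_trans q0).
have [d dD] : exists d, d \in D.
  by case: D D_neq0 => // d D' _; exists d; rewrite mem_head.
have Nm : (N <= n + g * m)%N by apply: leq_trans Nn _; rewrite leq_add2l.
have h : 0 <= e * (w (n + g * m - d)%N - a).
  by rewrite mulr_ge0 ?(ltW e_gt0) // subr_ge0 Ha'.
by rewrite -subr_ge0 (le_trans h) // Hw.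
Qed.

Lemma pulls_up_bounded_below (w : nat -> R) :
  pulls_up D N e w -> exists a : R, forall n, a <= w n.
Proof.
move=> Hw; have [b _ Hb] := initial_bound (fun n => - w n) N 0.
exists (- b); elim/ltn_ind=> n IH.
have [/Hb|Nn] := ltnP n N; first by rewrite lerNl.
have [d dD] : exists d, d \in D.
  by case: D D_neq0 => // d D' _; exists d; rewrite mem_head.
have IH' d' : d' \in D -> - b <= w (n - d')%N.
  by move=> /D_range /andP[d0 dK]; apply: IH; lia.
have := Hw n (- b) Nn IH' d dD.
have : 0 <= e * (w (n - d)%N - - b).
  by rewrite mulr_ge0 ?(ltW e_gt0) // subr_ge0 IH'.
by lra.
Qed.

(** The lift of the value at [n + g * K] is transported along sums of delays,
losing a factor [e] at each delay; once a full window has been lifted,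
[lower_bound_propagates] keeps it lifted. The offset [g * K] ensures that every
index involved stays in the progression starting at [n]. *)
Lemma pulls_up_along_multiples : exists T p : nat, (g %| T)%N /\
  forall (w : nat -> R) (n : nat) (a : R), pulls_up D N e w -> (N <= n)%N ->
    (forall m, a <= w (n + g * m)%N) ->
  forall m, a + e ^+ p * (w (n + g * K)%N - a) <= w (n + T + g * m)%N.
Proof.
have [Nf HNf] := multiples_of_gcd D.
have g0 := gcd_delays_gt0.
exists (g * K + g * Nf)%N, (g * Nf + K)%N; split=> [|w n a Hw Nn Ha].
  by rewrite dvdn_add ?dvdn_mulr.
have Kg : (K <= g * K)%N by rewrite leq_pmull.
have NfT : (Nf <= g * Nf)%N by rewrite leq_pmull.
set wK := w _.
have wa : 0 <= wK - a by rewrite subr_ge0; exact: Ha.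
apply: lower_bound_propagates => // [|m mK]; first by lia.
pose P t := (g %| t)%N /\ e ^+ t * (wK - a) <= w (n + g * K + t)%N - a.
have /HNf HP : P 0%N by rewrite /P dvdn0 addn0 expr0 mul1r.
have [] : P (g * Nf + g * m)%N.
- apply: HP => [d t dD [gt Pt]||]; last 2 first.
  + by lia.
  + by rewrite dvdn_add ?dvdn_mulr.
  have /andP[d0 dK] := D_range dD.
  split; first by rewrite dvdn_add // gcd_dvd.
  have Ha' d' : d' \in D -> a <= w (n + g * K + (t + d) - d')%N.
    move=> d'D; have /andP[_ d'K] := D_range d'D.
    have d'' : (d' <= g * K + (t + d))%N by lia.
    rewrite -addnA -addnBA //; have /dvdnP[q ->] : (g %| g * K + (t + d) - d')%N.
      by rewrite dvdn_sub ?(gcd_dvd d'D) // dvdn_add ?dvdn_mulr // dvdn_add // gcd_dvd.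
    by rewrite mulnC.
  have nN : (N <= n + g * K + (t + d))%N by lia.
  apply: le_trans (Hw _ _ nN Ha' d dD).
  rewrite addnA addnK; apply: le_trans (ler_wpM2l (ltW e_gt0) Pt).
  rewrite mulrA -exprS; apply: ler_wpM2r => //.
  by rewrite ler_wiXn2l ?(ltW e_gt0) //; lia.
move=> _; rewrite lerBrDl !addnA; apply: le_trans; rewrite lerD2l; apply: ler_wpM2r => //.
by rewrite ler_wiXn2l ?(ltW e_gt0) //; lia.
Qed.

(** The value at [n + g * K] lies either in the upper or in the lower half of
[a, b]; in the first case it raises the lower bound, in the second it
lowers the upper bound. *)
Lemma oscillation_contracts (w : nat -> R) :
    pulls_up D N e w -> pulls_up D N e (fun n => - w n) ->
  exists (T : nat) (t : R), 0 <= t < 1 /\ forall (n : nat) (a b : R), (N <= n)%N ->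
    (forall m, a <= w (n + g * m)%N <= b) ->
  exists a' b' : R, b' - a' = t * (b - a) /\
    forall m, a' <= w (n + T + g * m)%N <= b'.
Proof.
move=> wD wU; have [T [p [/dvdnP[q TE] HT]]] := pulls_up_along_multiples.
have ep0 : 0 < e ^+ p by rewrite exprn_gt0.
have ep1 : e ^+ p <= 1 by rewrite exprn_ile1 // ltW.
exists T, (1 - e ^+ p / 2); split; first by apply/andP; split; lra.
move=> n a b Nn wab.
have wa m : a <= w (n + g * m)%N by have /andP[] := wab m.
have wb m : - b <= - w (n + g * m)%N by rewrite lerN2; have /andP[] := wab m.
have TE' m : (n + T + g * m = n + g * (q + m))%N.
  by rewrite TE mulnDr addnA [(q * g)%N]mulnC.
have [mid|mid] := leP ((a + b) / 2) (w (n + g * K)%N).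
  exists (a + e ^+ p * ((b - a) / 2)), b; split=> [|m]; first by lra.
  have {2}-> := TE' m; have /andP[_ ->] := wab (q + m)%N; rewrite andbT.
  apply: le_trans (HT w n a wD Nn wa m).
  by rewrite lerD2l ler_wpM2l ?(ltW ep0) //; lra.
exists a, (b - e ^+ p * ((b - a) / 2)); split=> [|m]; first by lra.
have {1}-> := TE' m; have /andP[-> _] := wab (q + m)%N.
have := HT _ n (- b) wU Nn wb m; set v := w (n + T + _)%N.
have : e ^+ p * ((b - a) / 2) <= e ^+ p * (- w (n + g * K)%N - - b).
  by rewrite ler_wpM2l ?(ltW ep0) //; lra.
by move=> /=; lra.
Qed.

Lemma oscillation_vanishes (w : nat -> R) :
    pulls_up D N e w -> pulls_up D N e (fun n => - w n) ->
  forall eps : R, 0 < eps -> exists M : nat, forall n, (M <= n)%N ->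
    forall m, `|w (n + g * m)%N - w n| <= eps.
Proof.
move=> wD wU eps eps0.
have [T [t [t01 HT]]] := oscillation_contracts wD wU.
have [a Ha] := pulls_up_bounded_below wD.
have [b Hb] := pulls_up_bounded_below wU.
have claim (j : nat) : forall n, (N + j * T <= n)%N ->
    exists a' b', b' - a' = t ^+ j * (- b - a) /\
      forall m, a' <= w (n + g * m)%N <= b'.
  elim: j => [|j IH] n Nn.
  - exists a, (- b); split=> [|m]; first by rewrite expr0 mul1r.
    by rewrite Ha lerNr Hb.
  - have [|a1 [b1 [ab1 H1]]] := IH (n - T)%N; first by lia.
    have [|a2 [b2 [ab2 H2]]] := HT (n - T)%N a1 b1 _ H1; first by lia.
    exists a2, b2; split=> [|m]; first by rewrite ab2 ab1 exprS mulrA.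
    by have := H2 m; rewrite subnK //; lia.
have [j Hj] := geometric_eventually_le (- b - a) t01 eps0.
exists (N + j * T)%N => n /claim[a' [b' [ab' H]]] m.
have := H 0%N; rewrite muln0 addn0 => /andP[h1 h2].
have /andP[h3 h4] := H m; rewrite ler_norml; apply/andP; split; lra.
Qed.

End AveragingRecursions.

(** The limit along the progression of step [g] through [n], taken for each
[n], is automatically [g]-periodic; uniformity in [m] makes the convergence
uniform over the [g] progressions. *)
Lemma asymptotically_periodic (R : realType) (g : nat) (w : nat -> R) :
    (forall eps : R, 0 < eps -> exists M : nat, forall n, (M <= n)%N ->
      forall m, `|w (n + g * m)%N - w n| <= eps) ->
  exists2 c : nat -> R, has_period c g &
    forall eps : R, 0 < eps ->
      exists M : nat, forall n, (M <= n)%N -> `|w n - c n| <= eps.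
Proof.
move=> Hw.
pose c n := lim (w (n + g * m)%N @[m --> \oo]).
have cP n : w (n + g * m)%N @[m --> \oo] --> c n.
  apply: cauchy_cvg; apply: cauchy_exP => eps eps0.
  have eps2 : 0 < eps / 2 by rewrite divr_gt0.
  have [M HM] := Hw _ eps2.
  have [g0|g0] := posnP g.
    exists (w n); exists 0%N => // m _ /=.
    by rewrite g0 mul0n addn0; exact: ballxx.
  exists (w (n + g * M)%N); exists M => // m /= Mm.
  rewrite -ball_normE /= distrC -(subnKC Mm) mulnDr addnA.
  apply: le_lt_trans (HM _ _ _) _; last by lra.
  by apply: leq_trans (leq_addl _ _); rewrite leq_pmull.
exists c => [n|eps eps0].
  apply: cvg_lim => //; have := cP n; rewrite -cvg_shiftS /=.
  by under eq_fun do rewrite mulnS addnA.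
have [M HM] := Hw _ eps0; exists M => n Mn.
rewrite distrC; apply/ler_addgt0Pr => d d0.
have /cvgrPdist_le/(_ _ d0)[m _ /(_ m (leqnn m)) /=] := cP n.
have := HM n Mn m; rewrite [_ + d]addrC => h1 h2.
rewrite -(subrKA (w (n + g * m)%N)); apply: le_trans (ler_normD _ _) _.
exact: lerD.
Qed.

(** * Sums with the weights of the equation *)

Section WeightedSums.
Context (R : realType) (k : nat) (beta : nat -> R).
Hypothesis beta_ge0 : forall i : nat, (1 <= i <= k)%N -> 0 <= beta (2 * i)%N.

Lemma ler_weighted_sum (u v : nat -> R) :
    (forall i : nat, (1 <= i <= k)%N -> u i <= v i) ->
  \sum_(1 <= i < k.+1) beta (2 * i)%N * u i
    <= \sum_(1 <= i < k.+1) beta (2 * i)%N * v i.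
Proof.
by move=> uv; apply: ler_sum_nat => i ik; rewrite ler_wpM2l ?beta_ge0 ?uv.
Qed.

Lemma weighted_sum_cst (a : R) :
  \sum_(1 <= i < k.+1) beta (2 * i)%N * a
    = (\sum_(1 <= i < k.+1) beta (2 * i)%N) * a.
Proof. by rewrite mulr_suml. Qed.

Lemma weighted_sum_le (u : nat -> R) (a : R) :
    (forall i : nat, (1 <= i <= k)%N -> u i <= a) ->
  \sum_(1 <= i < k.+1) beta (2 * i)%N * u i
    <= (\sum_(1 <= i < k.+1) beta (2 * i)%N) * a.
Proof. by rewrite -weighted_sum_cst; exact: ler_weighted_sum. Qed.

Lemma weighted_sum_ge (u : nat -> R) (a : R) :
    (forall i : nat, (1 <= i <= k)%N -> a <= u i) ->
  (\sum_(1 <= i < k.+1) beta (2 * i)%N) * a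
    <= \sum_(1 <= i < k.+1) beta (2 * i)%N * u i.
Proof. by rewrite -weighted_sum_cst; exact: ler_weighted_sum. Qed.

Lemma weights_ge0 : 0 <= \sum_(1 <= i < k.+1) beta (2 * i)%N.
Proof. by rewrite big_nat sumr_ge0. Qed.

End WeightedSums.

(** * The recursion of the excess, straightened *)

(** The inversion [v |-> s / v] applied at odd indices only. It conjugates the
reduced recursion, whose odd delay acts decreasingly, to an averaging one. *)
Definition flip (R : realType) (s : R) (n : nat) (v : R) : R :=
  if odd n then s / v else v.

Lemma flipK (R : realType) (s : R) (n : nat) : s != 0 ->
  involutive (flip s n).
Proof.
move=> s0 v; rewrite /flip; case: odd => //.
by rewrite invf_div mulrCA divff // mulr1.
Qed.

Lemma flip_lipschitz (R : realType) (s a : R) (n : nat) (u v : R) :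
    0 < s -> 0 < a -> a <= u -> a <= v ->
  `|flip s n u - flip s n v| <= (1 + s / (a * a)) * `|u - v|.
Proof.
move=> s0 a0 au av; have u0 := lt_le_trans a0 au; have v0 := lt_le_trans a0 av.
have q0 : 0 <= s / (a * a) by rewrite divr_ge0 ?mulr_ge0 ?(ltW s0) ?(ltW a0).
rewrite /flip; case: odd; last by rewrite ler_peMl // lerDl.
have -> : s / u - s / v = s / (u * v) * (v - u) by field; rewrite !gt_eqF.
rewrite normrM distrC ler_wpM2r // ger0_norm; last first.
  by rewrite divr_ge0 ?mulr_ge0 ?(ltW s0) ?(ltW u0) ?(ltW v0).
apply: (@le_trans _ _ (s / (a * a))); last by rewrite lerDr.
rewrite ler_wpM2l ?(ltW s0) // lef_pV2 ?posrE ?mulr_gt0 //.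
by apply: ler_pM => //; exact: ltW.
Qed.

Lemma window_even k K i : (2 * k <= K)%N -> (1 <= i <= k)%N -> (0 < 2 * i <= K)%N.
Proof. by lia. Qed.

Lemma window_odd l K : odd l -> (l <= K)%N -> (0 < l <= K)%N.
Proof. by case: l. Qed.

Lemma window_ge N K n d : (N + K <= n)%N -> (0 < d <= K)%N -> (N <= n - d)%N.
Proof. by lia. Qed.

Lemma window_le N K n d : (N + K <= n)%N -> (0 < d <= K)%N -> (d <= n)%N.
Proof. by lia. Qed.

Lemma window_lt N K n d : (N + K <= n)%N -> (0 < d <= K)%N -> (n - d < n)%N.
Proof. by lia. Qed.

Lemma odd_sub_odd n l : odd l -> (l <= n)%N -> odd (n - l) = ~~ odd n.
Proof. by move=> ol ln; rewrite oddB // ol addbT. Qed.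

Lemma odd_sub_even n i : (2 * i <= n)%N -> odd (n - 2 * i) = odd n.
Proof. by move=> iN; rewrite oddB // oddM addbF. Qed.

Lemma I_beta_cases (R : realType) (k l : nat) (beta : nat -> R) (d : nat) :
  d \in I_beta k l beta -> d = l \/
  exists i, [/\ (1 <= i <= k)%N, 0 < beta (2 * i)%N & d = (2 * i)%N].
Proof.
rewrite inE => /orP[/eqP->|/mapP[i]]; first by left.
rewrite mem_filter mem_iota => /andP[bi ik] ->; right; by exists i.
Qed.

Lemma mem_I_beta_even (R : realType) (k l : nat) (beta : nat -> R) (i : nat) :
  (1 <= i <= k)%N -> 0 < beta (2 * i)%N ->
  (2 * i)%N \in I_beta k l beta.
Proof.
move=> ik bi; rewrite inE; apply/orP; right; apply/mapP; exists i => //.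
by rewrite mem_filter bi mem_iota; lia.
Qed.

Section Reduced.
Context (R : realType) (k l K N : nat) (beta : nat -> R) (kap c : R).
Variable y : nat -> R.
Hypothesis l_odd : odd l.
Hypothesis lK : (l <= K)%N.
Hypothesis kK : (2 * k <= K)%N.
Hypothesis beta_ge0 : forall i : nat, (1 <= i <= k)%N -> 0 <= beta (2 * i)%N.
Hypothesis kap_ge0 : 0 <= kap.
Hypothesis c_gt0 : 0 < c.
Hypothesis y_gt0 : forall n, (N <= n)%N -> 0 < y n.

Variable B : R.
Hypothesis BE : B = \sum_(1 <= i < k.+1) beta (2 * i)%N.

Hypothesis y_rec : forall n, (N + K <= n)%N ->
  y n * (kap + B + y (n - l)%N)
    = c * c + kap * c + \sum_(1 <= i < k.+1) beta (2 * i)%N * y (n - 2 * i)%N.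

(** The interval [c * c / M, M] is stable under the recursion because its
end points are exchanged by [v |-> c * c / v]: at the upper end
[c * c + kap * c + B * M <= M * (kap + B + c * c / M)] as soon as
[c <= M], and symmetrically at the lower end. *)
Lemma reduced_bounds : exists2 M, c <= M &
  forall n, (N <= n)%N -> c * c / M <= y n <= M.
Proof.
have kap0 := kap_ge0; have c0 := c_gt0.
have [M1 cM1 HM1] := initial_bound y (N + K) c.
have [M M1M HM] := initial_bound (fun n => c * c / y n) (N + K) M1.
have cM := le_trans cM1 M1M.
have M0 : 0 < M by exact: lt_le_trans cM.
have B0 : 0 <= B by rewrite BE weights_ge0.
exists M => //; elim/ltn_ind => n IH Nn.
have yn := y_gt0 Nn.
have [nK|nK] := ltnP n (N + K).
  apply/andP; split; last by rewrite (le_trans (HM1 _ nK)).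
  by have /= := HM n nK; rewrite !ler_pdivrMr // [M * _]mulrC.
have win d : (0 < d <= K)%N -> c * c / M <= y (n - d)%N <= M.
  by move=> dK; apply: IH; [exact: window_lt nK dK|exact: window_ge nK dK].
have /andP[y1 y2] := win l (window_odd l_odd lK).
have y' := y_gt0 (window_ge nK (window_odd l_odd lK)).
have s1 : \sum_(1 <= i < k.+1) beta (2 * i)%N * y (n - 2 * i)%N <= B * M.
  rewrite BE; apply: weighted_sum_le => // i ik.
  by have /andP[] := win (2 * i)%N (window_even kK ik).
have s2 : B * (c * c / M) <= \sum_(1 <= i < k.+1) beta (2 * i)%N * y (n - 2 * i)%N.
  rewrite BE; apply: weighted_sum_ge => // i ik.
  by have /andP[] := win (2 * i)%N (window_even kK ik).
have rec := y_rec nK.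
set m := c * c / M in y1 s2 *.
have mM : m * M = c * c by rewrite divfK // gt_eqF.
have m0 : 0 < m by rewrite divr_gt0 // mulr_gt0.
have mc : m <= c.
  by rewrite ler_pdivrMr // ler_wpM2l // ltW.
have T0 : 0 < kap + B + y (n - l)%N by lra.
apply/andP; split.
  rewrite -(ler_pM2r T0) rec.
  have h1 : m * y (n - l)%N <= m * M by rewrite ler_pM2l.
  have h2 : m * kap <= c * kap by rewrite ler_wpM2r.
  by rewrite [m * (_ + _)]mulrDr [m * (_ + _)]mulrDr; lra.
rewrite -(ler_pM2r T0) rec.
have h1 : M * m <= M * y (n - l)%N by rewrite ler_pM2l.
have h2 : c * kap <= M * kap by rewrite ler_wpM2r.
by rewrite [M * (_ + _)]mulrDr [M * (_ + _)]mulrDr; lra.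
Qed.

Let w n := flip (c * c) n (y n).

Lemma flip_bounds : exists2 M, c <= M & forall n, (N <= n)%N ->
  [/\ c * c / M <= y n, y n <= M, c * c / M <= w n & w n <= M].
Proof.
have [M cM HM] := reduced_bounds.
have M0 : 0 < M by exact: lt_le_trans cM.
exists M => // n Nn; have /andP[y1 y2] := HM n Nn; have yn := y_gt0 Nn.
have cc0 : 0 < c * c by rewrite mulr_gt0.
split => //; rewrite /w /flip; case: odd => //.
  by rewrite ler_pM2l // lef_pV2.
by move: y1; rewrite !ler_pdivrMr // [M * _]mulrC.
Qed.

(** For even [n] divide the recursion by [T = kap + B + y (n - l)] and write
[c * c = y (n - l) * w (n - l)]; for odd [n] take its inverse and multiply by
[c * c], which gives weights over [T = c * c + kap * c + \sum_i beta_(2i) y_(n-2i)].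
All weights are bounded below because [y] stays in a compact subset of the
positive half-line. *)
Lemma flip_convex : exists e : R, 0 < e <= 1 /\
  forall n, (N + K <= n)%N ->
  exists (r0 : R) (r : nat -> R) (r' : R),
    [/\ e <= r0, (forall i, (1 <= i <= k)%N -> e <= r i), e <= r',
        kap * r0 + \sum_(1 <= i < k.+1) beta (2 * i)%N * r i + r' = 1
      & w n = kap * r0 * c
              + \sum_(1 <= i < k.+1) beta (2 * i)%N * (r i * w (n - 2 * i)%N)
              + r' * w (n - l)%N].
Proof.
have kap0 := kap_ge0; have c0 := c_gt0.
have [M cM HM] := flip_bounds; have M0 := lt_le_trans c0 cM.
have cc0 : 0 < c * c by rewrite mulr_gt0.
have B0 : 0 <= B by rewrite BE weights_ge0.
set m := c * c / M in HM; have m0 : 0 < m by rewrite divr_gt0.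
pose Tmax := kap + B + M + (c * c + kap * c + B * M).
(* [u] bounds all numerators of the weights from below, [Tmax] all
   denominators from above. *)
pose u := Num.min (Num.min 1 c) (Num.min m (c * c)).
have u0 : 0 < u by rewrite !lt_min ltr01 c_gt0 m0 cc0.
have [u1 uc um uc2] : [/\ u <= 1, u <= c, u <= m & u <= c * c].
  by split; rewrite /u !ge_min lexx ?orbT.
have kc0 : 0 <= kap * c by rewrite mulr_ge0 // ltW.
have BM0 : 0 <= B * M by rewrite mulr_ge0 // ltW.
have Tmax0 : 0 < Tmax by rewrite /Tmax; lra.
exists (Num.min 1 (u / Tmax)); split.
  by rewrite lt_min ltr01 divr_gt0 //= ge_min lexx.
move=> n nK.
have small a T : 0 < T -> T <= Tmax -> u <= a -> Num.min 1 (u / Tmax) <= a / T.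
  move=> T0 TT ua; rewrite ge_min; apply/orP; right.
  apply: ler_pM => //; rewrite ?(ltW u0) ?invr_ge0 ?(ltW Tmax0) //.
  by rewrite lef_pV2.
have win d : (0 < d <= K)%N -> [/\ m <= y (n - d)%N, y (n - d)%N <= M & 0 < y (n - d)%N].
  move=> dK; have nd := window_ge nK dK.
  by have [] := HM _ nd; split => //; exact: y_gt0.
have [yl1 yl2 yl0] := win l (window_odd l_odd lK).
have yn := y_gt0 (leq_trans (leq_addr K N) nK).
have odd_l := odd_sub_odd l_odd (window_le nK (window_odd l_odd lK)).
have odd_i i ik := odd_sub_even (window_le nK (window_even (i := i) kK ik)).
have rec := y_rec nK.
have [on|en] := boolP (odd n).
- set T := c * c + kap * c + \sum_(1 <= i < k.+1) beta (2 * i)%N * y (n - 2 * i)%N in rec.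
  have s1 : \sum_(1 <= i < k.+1) beta (2 * i)%N * y (n - 2 * i)%N <= B * M.
    by rewrite BE; apply: weighted_sum_le => // i ik;
      have [] := win (2 * i)%N (window_even kK ik).
  have T0 : 0 < T by rewrite -rec mulr_gt0 //; lra.
  have TT : T <= Tmax by rewrite /T /Tmax; lra.
  exists (c / T), (fun i => y (n - 2 * i)%N / T), (c * c / T); split.
  + exact: small.
  + move=> i ik; have [h _ _] := win (2 * i)%N (window_even kK ik).
    by apply: small => //; exact: le_trans h.
  + exact: small.
  + under eq_bigr do rewrite mulrA.
    rewrite -mulr_suml mulrA -!mulrDl; apply/eqP; rewrite eq_sym -subr_eq0.
    by apply/eqP; rewrite /T; field; rewrite -/T gt_eqF.
  + rewrite /w /flip odd_l on /=.
    rewrite (eq_big_nat _ _ (F2 := fun i => beta (2 * i)%N * (c * c / T)))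
      => [|i ik]; last first.
      rewrite odd_i // on; congr (_ * _).
      have [_ _ h] := win (2 * i)%N (window_even kK ik).
      by field; rewrite !gt_eqF.
    rewrite -mulr_suml -BE.
    have -> : c * c / y n = c * c * (kap + B + y (n - l)%N) / T.
      by rewrite -rec; field; rewrite !gt_eqF //; lra.
    by field; rewrite gt_eqF.
- set T := kap + B + y (n - l)%N in rec.
  have T0 : 0 < T by rewrite /T; lra.
  have TT : T <= Tmax by rewrite /T /Tmax; lra.
  exists (1 / T), (fun i => 1 / T), (y (n - l)%N / T); split.
  + exact: small.
  + by move=> i ik; exact: small.
  + by apply: small => //; exact: le_trans yl1.
  + rewrite -mulr_suml -BE /T; field; by rewrite -/T gt_eqF.
  + rewrite /w /flip odd_l (negbTE en) /=.
    rewrite (eq_big_nat _ _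
      (F2 := fun i => beta (2 * i)%N * y (n - 2 * i)%N * (1 / T)))
      => [|i ik]; last first.
      by rewrite odd_i // (negbTE en); ring.
    rewrite -mulr_suml.
    have -> : y n = (y n * T) / T by rewrite mulfK // gt_eqF.
    rewrite rec; field; by rewrite !gt_eqF.
Qed.

(** The weight of [c] in [flip_convex] is at least [kap * e], so the distance
from [w] to [c] contracts by the factor [1 - kap * e]. *)
Lemma reduced_converges : 0 < kap ->
  forall eps : R, 0 < eps -> exists M : nat, forall n, (M <= n)%N -> `|y n - c| <= eps.
Proof.
move=> kap0 eps eps0; have c0 := c_gt0.
have [b cb Hb] := flip_bounds; have [e [/andP[e0 e1] He]] := flip_convex.
have b0 := lt_le_trans c0 cb.
have cc0 : 0 < c * c by rewrite mulr_gt0.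
set a := c * c / b in Hb; have a0 : 0 < a by rewrite divr_gt0.
have ac : a <= c by rewrite ler_pdivrMr // ler_wpM2l // ltW.
set L := 1 + c * c / (a * a).
have L0 : 0 < L by rewrite ltr_pwDl // divr_ge0 // mulr_ge0 // ltW.
have epsL : 0 < eps / L by rewrite divr_gt0.
have K0 : (0 < K)%N by have /andP[l0 lK'] := (window_odd l_odd lK); exact: leq_trans lK'.
have t1 : 1 - kap * e < 1 by rewrite ltrBlDr ltrDl mulr_gt0.
have [|M HM] := @eventually_le_of_contraction R (fun n => `|w n - c|) N K _ _ K0 epsL t1.
  move=> n M nK epsM Hwin; rewrite le_max; apply/orP; right.
  have M0 : 0 <= M by apply: le_trans epsM; exact: ltW.
  have [r0 [r [r' [er0 er er' sum1 wE]]]] := He n nK.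
  have -> : w n - c = \sum_(1 <= i < k.+1) beta (2 * i)%N * (r i * (w (n - 2 * i)%N - c))
      + r' * (w (n - l)%N - c).
    under eq_bigr do rewrite mulrBr mulrBr [X in _ - X]mulrA.
    rewrite sumrB -mulr_suml wE.
    have -> : kap * r0 = 1 - \sum_(1 <= i < k.+1) beta (2 * i)%N * r i - r'.
      by rewrite -sum1; ring.
    by ring.
  have hs : `|\sum_(1 <= i < k.+1) beta (2 * i)%N * (r i * (w (n - 2 * i)%N - c))|
      <= \sum_(1 <= i < k.+1) beta (2 * i)%N * r i * M.
    apply: le_trans (ler_norm_sum _ _ _) _; apply: ler_sum_nat => i ik.
    have ri0 : 0 <= r i by apply: le_trans (er i ik); exact: ltW.
    rewrite !normrM (ger0_norm (beta_ge0 ik)) (ger0_norm ri0) -mulrA.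
    rewrite ler_wpM2l ?beta_ge0 // ler_wpM2l //.
    by apply: Hwin; exact: (window_even kK).
  have r'0 : 0 <= r' by apply: le_trans er'; exact: ltW.
  have hl : `|r' * (w (n - l)%N - c)| <= r' * M.
    rewrite normrM (ger0_norm r'0) ler_wpM2l //.
    by apply: Hwin; exact: (window_odd l_odd lK).
  apply: le_trans (ler_normD _ _) _; apply: le_trans (lerD hs hl) _.
  rewrite -mulr_suml -mulrDl ler_wpM2r //.
  have : kap * e <= kap * r0 by rewrite ler_wpM2l // ltW.
  by move: sum1; lra.
exists (maxn M N) => n; rewrite geq_max => /andP[/HM wM Nn].
have [ya yb wa wb] := Hb n Nn.
have -> : y n = flip (c * c) n (w n) by rewrite /w flipK // gt_eqF.
have cE : flip (c * c) n c = c.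
  by rewrite /flip; case: odd => //; rewrite mulfK // gt_eqF.
rewrite -[X in `|_ - X|]cE.
apply: le_trans (flip_lipschitz n cc0 a0 wa ac) _.
by rewrite -/L mulrC -ler_pdivlMr.
Qed.

Lemma I_beta_range d : d \in I_beta k l beta -> (0 < d <= K)%N.
Proof.
move=> /I_beta_cases[->|[i [ik _ ->]]].
  exact: (window_odd l_odd lK).
exact: (window_even kK).
Qed.

Lemma positive_weight_lb : exists2 b : R, 0 < b <= 1 &
  forall i, (1 <= i <= k)%N -> 0 < beta (2 * i)%N -> b <= beta (2 * i)%N.
Proof.
have [M M1 HM] := initial_bound (fun i => (beta (2 * i)%N)^-1) k.+1 1.
have M0 : 0 < M by exact: lt_le_trans M1.
exists M^-1; first by rewrite invr_gt0 M0 invf_le1.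
move=> i /andP[_ ik] bi; have /= := HM i ik.
by rewrite -[leRHS]invrK lef_pV2 ?posrE ?invr_gt0.
Qed.

(** Weights [beta (2 * i)] that vanish contribute nothing, so only the delays in
[I_beta] need to respect the lower bound [a]; each of those keeps a weight of
at least [e * b]. *)
Lemma convex_pulls_up (u : nat -> R) (e b : R) (n : nat) (r : nat -> R) (r' a : R) :
    0 < e -> 0 < b <= 1 ->
    (forall i, (1 <= i <= k)%N -> 0 < beta (2 * i)%N -> b <= beta (2 * i)%N) ->
    (forall i, (1 <= i <= k)%N -> e <= r i) -> e <= r' ->
    \sum_(1 <= i < k.+1) beta (2 * i)%N * r i + r' = 1 ->
    u n = \sum_(1 <= i < k.+1) beta (2 * i)%N * (r i * u (n - 2 * i)%N)
          + r' * u (n - l)%N ->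
    (forall d, d \in I_beta k l beta -> a <= u (n - d)%N) ->
  forall d, d \in I_beta k l beta -> e * b * (u (n - d)%N - a) <= u n - a.
Proof.
move=> e0 /andP[b0 b1] Hb er er' sum1 uE Ha d dI.
have -> : u n - a = \sum_(1 <= i < k.+1) beta (2 * i)%N * (r i * (u (n - 2 * i)%N - a))
      + r' * (u (n - l)%N - a).
  under eq_bigr do rewrite mulrBr mulrBr [X in _ - X]mulrA.
  by rewrite sumrB -mulr_suml uE -[X in _ - X]mul1r -sum1; ring.
have term0 i : (1 <= i <= k)%N -> 0 <= beta (2 * i)%N * (r i * (u (n - 2 * i)%N - a)).
  move=> ik; have := beta_ge0 ik; rewrite le_eqVlt => /orP[/eqP<-|bi].
    by rewrite mul0r.
  rewrite mulr_ge0 ?(ltW bi) // mulr_ge0 //.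
    by apply: le_trans (er i ik); exact: ltW.
  by rewrite subr_ge0 Ha // mem_I_beta_even.
have l0 : 0 <= u (n - l)%N - a by rewrite subr_ge0 Ha // mem_head.
have r'0 : 0 <= r' by apply: le_trans er'; exact: ltW.
have [->|[i [ik bi ->]]] := I_beta_cases dI.
  apply: (@le_trans _ _ (r' * (u (n - l)%N - a))).
    by rewrite ler_wpM2r // (le_trans _ er') // ler_piMr // ltW.
  by rewrite lerDr big_nat sumr_ge0.
have iI : i \in index_iota 1 k.+1 by rewrite mem_index_iota.
rewrite (big_rem i) //= -addrA.
apply: (@le_trans _ _ (beta (2 * i)%N * (r i * (u (n - 2 * i)%N - a)))).
  rewrite mulrA [e * b]mulrC ler_wpM2r ?subr_ge0 ?Ha ?mem_I_beta_even //.
  by apply: ler_pM => //; [exact: ltW|exact: ltW|exact: Hb|exact: er].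
rewrite lerDl addr_ge0 ?mulr_ge0 // big_seq sumr_ge0 // => j /mem_rem.
by rewrite mem_index_iota; exact: term0.
Qed.

(** For [kap = 0] the constant [c] drops out of the averages, so both [w] and
[- w] satisfy [pulls_up] with the delays of [I_beta]. The limit stays away
from [0] because [w] does, which makes flipping back continuous. *)
Lemma reduced_asymptotically_periodic : kap = 0 ->
  exists C : nat -> R, [/\ has_period C (gcd_I_beta k l beta),
    forall n, 0 < C n &
    forall eps : R, 0 < eps -> exists M : nat, forall n, (M <= n)%N ->
      `|y n - flip (c * c) n (C n)| <= eps].
Proof.
move=> kap0; have c0 := c_gt0.
have [b cb Hb] := flip_bounds; have [e [/andP[e0 e1] He]] := flip_convex.
have b0 := lt_le_trans c0 cb.
have cc0 : 0 < c * c by rewrite mulr_gt0.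
set a := c * c / b in Hb; have a0 : 0 < a by rewrite divr_gt0.
have [be be01 Hbe] := positive_weight_lb.
have pull (u : nat -> R) : (forall n, (N + K <= n)%N ->
  exists (r : nat -> R) (r' : R), [/\ (forall i, (1 <= i <= k)%N -> e <= r i), e <= r',
    \sum_(1 <= i < k.+1) beta (2 * i)%N * r i + r' = 1
    & u n = \sum_(1 <= i < k.+1) beta (2 * i)%N * (r i * u (n - 2 * i)%N)
              + r' * u (n - l)%N]) ->
    pulls_up (I_beta k l beta) (N + K) (e * be) u.
  move=> Hu n a' nK Ha'; have [r [r' [H1 H2 H3 H4]]] := Hu n nK.
  exact: (convex_pulls_up e0 be01 Hbe H1 H2 H3 H4).
have pw : pulls_up (I_beta k l beta) (N + K) (e * be) w.
  apply: pull => n nK; have [r0 [r [r' [_ H1 H2 H3 H4]]]] := He n nK.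
  exists r, r'; split => //; first by rewrite -H3 kap0 mul0r add0r.
  by rewrite H4 kap0 !mul0r add0r.
have pNw : pulls_up (I_beta k l beta) (N + K) (e * be) (fun n => - w n).
  apply: pull => n nK; have [r0 [r [r' [_ H1 H2 H3 H4]]]] := He n nK.
  exists r, r'; split => //; first by rewrite -H3 kap0 mul0r add0r.
  under eq_bigr do rewrite mulrN mulrN.
  by rewrite sumrN mulrN -opprD H4 kap0 !mul0r add0r.
have /andP[be0 be1] := be01.
have ebe0 : 0 < e * be by rewrite mulr_gt0.
have ebe1 : e * be <= 1 by rewrite mulr_ile1 // ltW.
have I0 : I_beta k l beta != [::] by [].
have KN := leq_addl N K.
have g0 := gcd_delays_gt0 I0 I_beta_range.
have [C Cg HC] := asymptotically_periodic
  (oscillation_vanishes I0 I_beta_range KN ebe0 ebe1 pw pNw).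
have Ca n : a <= C n.
  apply/ler_addgt0Pr => eps eps0; have [M HM] := HC eps eps0.
  have Cm m : C (n + m * \big[gcdn/0%N]_(d <- I_beta k l beta) d)%N = C n.
    by elim: m => [|m IH]; rewrite ?mul0n ?addn0 // mulSnr addnA Cg IH.
  set m := (M + N)%N; have nm : (m <= n + m * \big[gcdn/0%N]_(d <- I_beta k l beta) d)%N.
    by apply: leq_trans (leq_addl _ _); rewrite leq_pmulr.
  have := HM _ (leq_trans (leq_addr N M) nm); rewrite Cm ler_norml => /andP[_ h].
  have [_ _ wa _] := Hb _ (leq_trans (leq_addl M N) nm).
  by move: h wa; lra.
exists C; split=> [//|n|eps eps0]; first exact: lt_le_trans (Ca n).
set L := 1 + c * c / (a * a).
have L0 : 0 < L by rewrite ltr_pwDl // divr_ge0 // mulr_ge0 // ltW.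
have epsL : 0 < eps / L by rewrite divr_gt0.
have [M HM] := HC _ epsL.
exists (maxn M N) => n; rewrite geq_max => /andP[/HM wM Nn].
have [ya yb wa wb] := Hb n Nn.
have -> : y n = flip (c * c) n (w n) by rewrite /w flipK // gt_eqF.
apply: le_trans (flip_lipschitz n cc0 a0 wa (Ca n)) _.
by rewrite -/L mulrC -ler_pdivlMr.
Qed.

End Reduced.

(** * Positive solutions and their convergence to an equilibrium *)

Section PositiveSolutions.
Context (R : realType) (k l : nat) (alpha A : R) (beta : nat -> R).
Hypothesis l_odd : odd l.
Hypothesis alpha_ge0 : 0 <= alpha.
Hypothesis A_ge0 : 0 <= A.
Hypothesis beta_ge0 : forall i : nat, (1 <= i <= k)%N -> 0 <= beta (2 * i)%N.

Variable B : R.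
Hypothesis BE : B = \sum_(1 <= i < k.+1) beta (2 * i)%N.

Notation K := (delay k l).

Lemma l_le_delay : (l <= K)%N. Proof. exact: leq_maxr. Qed.
Lemma k_le_delay : (2 * k <= K)%N. Proof. exact: leq_maxl. Qed.

Lemma delay_even i : (1 <= i <= k)%N -> (0 < 2 * i <= K)%N.
Proof. exact: (window_even k_le_delay). Qed.

Lemma delay_odd : (0 < l <= K)%N.
Proof. exact: (window_odd l_odd l_le_delay). Qed.

Lemma delay_gt0 : (0 < K)%N.
Proof. by have /andP[] := delay_odd; exact: leq_trans. Qed.

Lemma B_ge0 : 0 <= B. Proof. by rewrite BE; exact: weights_ge0. Qed.

Lemma solution_gt0 (x : nat -> R) :
  is_positive_solution k l alpha A beta x -> forall n, 0 < x n.
Proof.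
move=> [x0 xrec]; elim/ltn_ind => n IH.
have [/x0//|nK] := ltnP n K.
have [_ ->] := xrec n nK.
have xl : 0 < x (n - l)%N by apply: IH; apply: (window_lt (N := 0) nK delay_odd).
have xs : 0 <= \sum_(1 <= i < k.+1) beta (2 * i)%N * x (n - 2 * i)%N.
  rewrite big_nat sumr_ge0 // => i ik; rewrite mulr_ge0 ?beta_ge0 // ltW //.
  by apply: IH; apply: (window_lt (N := 0) nK (delay_even ik)).
have a0 := alpha_ge0; have A0 := A_ge0.
by rewrite divr_gt0 //; lra.
Qed.

Lemma solution_rec (x : nat -> R) (n : nat) :
    is_positive_solution k l alpha A beta x -> (K <= n)%N ->
  x n * (A + x (n - l)%N)
    = alpha + \sum_(1 <= i < k.+1) beta (2 * i)%N * x (n - 2 * i)%N + x (n - l)%N.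
Proof. by move=> [_ xrec] /xrec[neq0 ->]; rewrite divfK. Qed.

Lemma solution_of_rec (x : nat -> R) : (forall n, 0 < x n) ->
    (forall n, (K <= n)%N -> x n * (A + x (n - l)%N)
    = alpha + \sum_(1 <= i < k.+1) beta (2 * i)%N * x (n - 2 * i)%N + x (n - l)%N) ->
  is_positive_solution k l alpha A beta x.
Proof.
move=> x0 xrec; split=> // n nK.
have d0 : A + x (n - l)%N != 0 by rewrite gt_eqF // ltr_wpDl // x0.
by rewrite -xrec // mulfK.
Qed.

Lemma excess_rec (x : nat -> R) (n : nat) :
    is_positive_solution k l alpha A beta x -> (K <= n)%N ->
  (x n - 1) * (A + x (n - l)%N)
    = alpha + B - A + \sum_(1 <= i < k.+1) beta (2 * i)%N * (x (n - 2 * i)%N - 1).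
Proof.
move=> xs nK; under eq_bigr do rewrite mulrBr mulr1.
by rewrite sumrB -BE mulrBl solution_rec //; ring.
Qed.

(** If the last [K] values are at least [m <= 1], the next one is at least [1]
or at least [m * (alpha + B + 1) / (A + 1)]; the factor exceeds [1], so the
inverse of [x] contracts down to the level [1]. Strictness comes from one
more application of the recursion. *)
Lemma eventually_gt1 (x : nat -> R) :
    is_positive_solution k l alpha A beta x -> A < alpha + B ->
  exists N, forall n, (N <= n)%N -> 1 < x n.
Proof.
move=> xs AB; have x0 := solution_gt0 xs.
have a0 := alpha_ge0; have A0 := A_ge0; have B0 := B_ge0.
have t1 : (A + 1) / (alpha + B + 1) < 1.
  by rewrite ltr_pdivrMr; lra.
have [|N HN] := @eventually_le_of_contraction R (fun n => (x n)^-1) 0 K 1 _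
  delay_gt0 ltr01 t1.
  move=> n M nK M1 Hwin; rewrite le_max.
  have M0 : 0 < M by exact: lt_le_trans M1.
  have win d : (0 < d <= K)%N -> M^-1 <= x (n - d)%N.
    by move=> /Hwin h; rewrite -[leRHS]invrK lef_pV2 ?posrE ?invr_gt0.
  have m0 : 0 < M^-1 by rewrite invr_gt0.
  have m1 : M^-1 <= 1 by rewrite invf_le1.
  have [x1|x1] := leP 1 (x n); first by rewrite invf_le1 ?x1.
  apply/orP; right.
  have hl := win l delay_odd.
  have hs : B * M^-1 <= \sum_(1 <= i < k.+1) beta (2 * i)%N * x (n - 2 * i)%N.
    by rewrite BE; apply: weighted_sum_ge => // i ik; exact: win (delay_even ik).
  have rec := solution_rec xs nK.
  have -> : (A + 1) / (alpha + B + 1) * M = (M^-1 * (alpha + B + 1) / (A + 1))^-1.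
    by field; rewrite !gt_eqF //; lra.
  have ab0 : 0 < alpha + B + 1 by lra.
  have A1 : 0 < A + 1 by lra.
  rewrite lef_pV2 ?posrE ?divr_gt0 ?mulr_gt0 // ler_pdivrMr //.
  set m := M^-1 in m0 m1 hl hs *; set xl := x (n - l)%N in rec hl.
  (* [x n] is at least [(alpha + B * m + m) / (A + m)] because [x n < 1] makes the
     quotient increasing in [x (n - l)]; then [m <= 1] finishes. *)
  have h1 : 0 <= (1 - x n) * (xl - m) by rewrite mulr_ge0; lra.
  have h2 : 0 <= x n * (1 - m) by rewrite mulr_ge0 ?(ltW (x0 n)); lra.
  have h3 : 0 <= alpha * (1 - m) by rewrite mulr_ge0; lra.
  by move: rec h1 h2 h3 hs; lra.
exists (N + K)%N => n nN.
have xge1 d : (0 < d <= K)%N -> 1 <= x (n - d)%N.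
  by move=> /(window_ge nN)/HN; rewrite invf_le1.
have nK : (K <= n)%N by apply: leq_trans nN; exact: leq_addl.
have rec := excess_rec xs nK.
have hs : 0 <= \sum_(1 <= i < k.+1) beta (2 * i)%N * (x (n - 2 * i)%N - 1).
  rewrite big_nat sumr_ge0 // => i ik; rewrite mulr_ge0 ?beta_ge0 // subr_ge0.
  exact: xge1 (delay_even ik).
have T0 : 0 < A + x (n - l)%N by rewrite ltr_wpDl.
by rewrite -subr_gt0 -(pmulr_lgt0 _ T0) rec; lra.
Qed.

Lemma excess_reduced (x : nat -> R) (c : R) (N : nat) :
    is_positive_solution k l alpha A beta x ->
    c * c + (A + 1 - B) * c = alpha + B - A ->
  forall n, (N + K <= n)%N ->
  (x n - 1) * ((A + 1 - B) + B + (x (n - l)%N - 1))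
    = c * c + (A + 1 - B) * c
      + \sum_(1 <= i < k.+1) beta (2 * i)%N * (x (n - 2 * i)%N - 1).
Proof.
move=> xs -> n nN.
have nK : (K <= n)%N by apply: leq_trans nN; exact: leq_addl.
by rewrite -(excess_rec xs nK); ring.
Qed.

Lemma converges_above (x : nat -> R) :
    is_positive_solution k l alpha A beta x -> B < A + 1 -> A < alpha + B ->
  exists2 c : R, is_equilibrium k l alpha A beta c & x n @[n --> \oo] --> c.
Proof.
move=> xs BA AB; have A0 := A_ge0; have B0 := B_ge0.
have [|c [c0 _ cE]] := @quadratic_root R (A + 1 - B) (alpha + B - A); first lra.
have cgt0 : 0 < c.
  rewrite lt_neqAle c0 andbT; apply/eqP => cz; move: cE; rewrite -cz; lra.
have [N HN] := eventually_gt1 xs AB.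
exists (1 + c).
  move=> n nK; have d0 : A + (1 + c) != 0 by rewrite gt_eqF //; lra.
  split => //; apply: (mulIf d0); rewrite divfK // -mulr_suml -BE.
  by move: cE; lra.
apply: cvg_of_eventually_le => e e0.
have [|||M HM] := @reduced_converges R k l K N beta (A + 1 - B) c (fun n => x n - 1)
  l_odd l_le_delay k_le_delay beta_ge0 _ cgt0 _ B BE (excess_reduced xs cE) _ e e0.
- by lra.
- by move=> n /HN; rewrite subr_gt0.
- by lra.
by exists M => n /HM; rewrite opprD addrA.
Qed.

(** With [c] the larger root of [c * c + (A - 1 - B) * c = alpha], subtracting
the equilibrium equation gives
[(x n - c) (A + x (n - l)) = \sum_i beta_(2i) (x (n - 2i) - c) + (1 - c) (x (n - l) - c)],
where [c <= 1] and [A >= B + 1 - c]. If [c > 0], a lower bound [m <= c] of the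
initial values persists, and the deviation contracts by
[(B + 1 - c) / (B + 1 - c + m)]. If [c = 0], then [alpha = 0] and solutions
tend to [0], possibly slower than geometrically, but above any level [e <= 1]
the factor is at most [(B + 1) / (B + 1 + e)]. *)
Lemma converges_below (x : nat -> R) :
    is_positive_solution k l alpha A beta x -> alpha + B <= A ->
  exists2 c : R, is_equilibrium k l alpha A beta c & x n @[n --> \oo] --> c.
Proof.
move=> xs AB; have x0 := solution_gt0 xs.
have a0 := alpha_ge0; have A0 := A_ge0; have B0 := B_ge0.
have [c [c0 cp cE]] := @quadratic_root R (A - 1 - B) alpha a0.
have c1 : c <= 1.
  rewrite leNgt; apply/negP => c1.
  have : 0 <= (c - 1) * (c + (A - 1 - B)) by rewrite mulr_ge0; lra.
  move: cE; nra.
exists c.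
  move=> n nK; have d0 : A + c != 0.
    apply/negP => /eqP h; have cz : c = 0 by lra.
    by move: cp; lra.
  split => //; apply: (mulIf d0); rewrite divfK // -mulr_suml -BE.
  by move: cE; lra.
have dev n : (K <= n)%N -> (x n - c) * (A + x (n - l)%N)
    = \sum_(1 <= i < k.+1) beta (2 * i)%N * (x (n - 2 * i)%N - c)
      + (1 - c) * (x (n - l)%N - c).
  move=> nK; under eq_bigr do rewrite mulrBr.
  by rewrite sumrB -mulr_suml -BE mulrBl solution_rec //; move: cE; lra.
apply: cvg_of_eventually_le => e e0.
have T0 n : 0 < A + x (n - l)%N by rewrite ltr_wpDl.
have [cz|cgt0] : c = 0 \/ 0 < c.
  by move: c0; rewrite le_eqVlt => /orP[/eqP<-|]; [left|right].
- have az : alpha = 0 by move: cE; rewrite cz; lra.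
  pose e' := Num.min e 1.
  have e'0 : 0 < e' by rewrite lt_min e0 ltr01.
  have e'1 : e' <= 1 by rewrite ge_min lexx orbT.
  have t1 : (B + 1) / (B + 1 + e') < 1 by rewrite ltr_pdivrMr; lra.
  have [|N HN] := @eventually_le_of_contraction R x 0 K e' _ delay_gt0 e'0 t1.
    move=> n M nK eM Hwin; rewrite le_max; apply/orP; right.
    have hl := Hwin l delay_odd.
    have hs : \sum_(1 <= i < k.+1) beta (2 * i)%N * x (n - 2 * i)%N <= B * M.
      by rewrite BE; apply: weighted_sum_le => // i ik; exact: Hwin (delay_even ik).
    have rec := solution_rec xs nK.
    have be0 : 0 < B + 1 + e' by lra.
    rewrite mulrAC ler_pdivlMr // -(ler_pM2r (T0 n)) mulrAC rec az add0r.
    have xl0 := x0 (n - l)%N.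
    set xl := x (n - l)%N in hl xl0 *.
    apply: (@le_trans _ _ ((B * M + xl) * (B + 1 + e'))).
      by rewrite ler_pM2r //; lra.
    apply: (@le_trans _ _ ((B + 1) * M * (B + 1 + xl))); last first.
      rewrite ler_wpM2l ?mulr_ge0 //; by lra.
    have h1 : 0 <= B * M * (1 - e') by rewrite !mulr_ge0 //; lra.
    have [M1|M1] := leP 1 M.
      have h2 : 0 <= xl * (M - 1) by rewrite mulr_ge0 //; lra.
      have h3 : 0 <= B * (xl * (M - 1)) by rewrite mulr_ge0.
      have h4 : 0 <= xl * (1 - e') by rewrite mulr_ge0; lra.
      by nra.
    have h2 : 0 <= (M - xl) * (1 - M) * (B + 1) by rewrite !mulr_ge0; lra.
    have h3 : 0 <= e' * (M - xl) by rewrite mulr_ge0; lra.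
    have h4 : 0 <= M * (B + 1) * (M - e') by rewrite !mulr_ge0; lra.
    by nra.
  exists N => n /HN h; rewrite cz subr0 gtr0_norm //; apply: le_trans h _.
  by rewrite ge_min lexx.
have [M cM HM] := initial_bound (fun n => (x n)^-1) K c^-1.
have M0 : 0 < M by apply: lt_le_trans cM; rewrite invr_gt0.
have m0 : 0 < M^-1 by rewrite invr_gt0.
have mc : M^-1 <= c by rewrite -[leRHS]invrK lef_pV2 ?posrE ?invr_gt0.
have Ac n : B + 1 - c + x (n - l)%N <= A + x (n - l)%N by lra.
have lb n : M^-1 <= x n.
  elim/ltn_ind: n => n IH.
  have [/HM h|nK] := ltnP n K; first by rewrite -[leRHS]invrK lef_pV2 ?posrE ?invr_gt0.
  have win d : (0 < d <= K)%N -> M^-1 <= x (n - d)%N.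
    by move=> dK; apply: IH; apply: (window_lt (N := 0) nK dK).
  have hl := win l delay_odd.
  have hs : B * (M^-1 - c) <= \sum_(1 <= i < k.+1) beta (2 * i)%N * (x (n - 2 * i)%N - c).
    rewrite BE; apply: weighted_sum_ge => // i ik; rewrite lerD2r.
    exact: win (delay_even ik).
  suff : (M^-1 - c) * (A + x (n - l)%N) <= (x n - c) * (A + x (n - l)%N).
    by rewrite ler_pM2r // lerD2r.
  rewrite dev //.
  have h1 : 0 <= (c - M^-1) * (A - 1 - B + c + x (n - l)%N).
    by rewrite mulr_ge0; have := x0 (n - l)%N; lra.
  have h2 : (1 - c) * (M^-1 - c) <= (1 - c) * (x (n - l)%N - c).
    by rewrite ler_wpM2l; lra.
  by move: h1 h2 hs; lra.
have t1 : (B + 1 - c) / (B + 1 - c + M^-1) < 1 by rewrite ltr_pdivrMr; lra.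
have [|N HN] := @eventually_le_of_contraction R (fun n => `|x n - c|) 0 K e _
  delay_gt0 e0 t1; last first.
  by exists N => n /HN.
move=> n W nK eW Hwin; rewrite le_max; apply/orP; right.
have W0 : 0 <= W by apply: le_trans eW; exact: ltW.
have hl := Hwin l delay_odd.
have hs : `|\sum_(1 <= i < k.+1) beta (2 * i)%N * (x (n - 2 * i)%N - c)| <= B * W.
  apply: le_trans (ler_norm_sum _ _ _) _; rewrite BE mulr_suml.
  apply: ler_sum_nat => i ik; rewrite normrM (ger0_norm (beta_ge0 ik)).
  by rewrite ler_wpM2l ?beta_ge0 //; exact: Hwin (delay_even ik).
have hd : `|x n - c| * (A + x (n - l)%N) <= (B + 1 - c) * W.
  rewrite -[X in _ * X <= _](gtr0_norm (T0 n)) -normrM dev //.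
  apply: le_trans (ler_normD _ _) _.
  have : `|(1 - c) * (x (n - l)%N - c)| <= (1 - c) * W.
    by rewrite normrM ger0_norm ?ler_wpM2l //; lra.
  by move: hs; lra.
have d0 : 0 < B + 1 - c + M^-1 by lra.
rewrite mulrAC ler_pdivlMr //; apply: le_trans hd.
by rewrite ler_wpM2l //; have := lb (n - l)%N; have := Ac n; lra.
Qed.

End PositiveSolutions.

(** * Periodic limits and unbounded solutions *)

Section PeriodicAndUnbounded.
Context (R : realType) (k l : nat) (alpha A : R) (beta : nat -> R).
Hypothesis l_odd : odd l.
Hypothesis alpha_ge0 : 0 <= alpha.
Hypothesis A_ge0 : 0 <= A.
Hypothesis beta_ge0 : forall i : nat, (1 <= i <= k)%N -> 0 <= beta (2 * i)%N.

Variable B : R.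
Hypothesis BE : B = \sum_(1 <= i < k.+1) beta (2 * i)%N.

Notation K := (delay k l).
Notation g := (gcd_I_beta k l beta).

Lemma gcd_I_beta_dvd : (g %| l)%N.
Proof. exact: (gcd_dvd (mem_head _ _)). Qed.

Lemma gcd_I_beta_odd : odd g.
Proof. exact: dvdn_odd gcd_I_beta_dvd l_odd. Qed.

Lemma periodic_dvd (C : nat -> R) (n d : nat) : has_period C g ->
  (g %| d)%N -> (d <= n)%N -> C (n - d)%N = C n.
Proof.
move=> Cg /dvdnP[q ->] dn; rewrite -{2}(subnK dn).
elim: q {dn} (_ - _)%N => [|q IH] m; rewrite ?mul0n ?addn0 //.
by rewrite mulSn addnCA [(g + _)%N]addnC Cg.
Qed.

Lemma flip_periodic (s : R) (C : nat -> R) : has_period C g ->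
  has_period (fun n => 1 + flip s n (C n)) (2 * g)%N.
Proof.
by move=> Cg n; rewrite /flip oddD oddM addbF mul2n -addnn addnA !Cg.
Qed.

(** Since [l] is an odd multiple of [g], the values at [n] and [n - l] are
[v] and [s / v] for a common [v] and have product [s = alpha + 1], while the
values at [n] and [n - 2i] agree whenever [beta (2 * i)] is positive. The
recursion for the excess then reduces to [v * B + s = s + B * v]. *)
Lemma flip_solution (C : nat -> R) : A + 1 = B -> has_period C g ->
    (forall n, 0 < C n) ->
  is_positive_solution k l alpha A beta
    (fun n => 1 + flip (alpha + 1) n (C n)).
Proof.
move=> AB Cg C0; set s := alpha + 1.
have a0 := alpha_ge0; have s0 : 0 < s by rewrite /s; lra.
have Y0 n : 0 < flip s n (C n) by rewrite /flip; case: odd; rewrite ?divr_gt0.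
apply: solution_of_rec => // [n|n nK]; first by rewrite ltr_wpDl.
have ln := window_le (N := 0) nK (delay_odd k l_odd).
have prod : flip s n (C n) * flip s (n - l) (C (n - l)%N) = s.
  rewrite /flip odd_sub_odd // (periodic_dvd Cg gcd_I_beta_dvd ln).
  by case: odd => /=; [rewrite divfK|rewrite mulrC divfK] => //; rewrite gt_eqF.
have -> : \sum_(1 <= i < k.+1) beta (2 * i)%N * (1 + flip s (n - 2 * i) (C (n - 2 * i)%N))
    = B * (1 + flip s n (C n)).
  rewrite BE -weighted_sum_cst; apply: eq_big_nat => i ik.
  have := beta_ge0 ik; rewrite le_eqVlt => /orP[/eqP<-|bi]; first by rewrite !mul0r.
  have iN := window_le (N := 0) nK (delay_even l ik).
  rewrite (periodic_dvd Cg) //; last exact: (gcd_dvd (mem_I_beta_even l ik bi)).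
  by rewrite /flip odd_sub_even.
by move: prod; rewrite /s -AB; nra.
Qed.

Lemma converges_to_periodic (x : nat -> R) : A + 1 = B ->
    is_positive_solution k l alpha A beta x ->
  exists y : nat -> R, [/\ is_positive_solution k l alpha A beta y,
    has_period y (2 * g)%N & (x n - y n) @[n --> \oo] --> (0 : R)].
Proof.
move=> AB xs; have a0 := alpha_ge0; have A0 := A_ge0.
pose c := Num.sqrt (alpha + 1).
have c0 : 0 < c by rewrite sqrtr_gt0; lra.
have cc : c * c = alpha + 1 by rewrite -expr2 sqr_sqrtr //; lra.
have cE : c * c + (A + 1 - B) * c = alpha + B - A by rewrite cc -AB; ring.
have [|N HN] := eventually_gt1 l_odd alpha_ge0 A_ge0 beta_ge0 BE xs; first lra.
have [|||C [Cg C0 HC]] := @reduced_asymptotically_periodic R k l K N beta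
  (A + 1 - B) c (fun n => x n - 1) l_odd (l_le_delay k l) (k_le_delay k l)
  beta_ge0 _ c0 _ B BE (excess_reduced BE xs cE) _.
- by lra.
- by move=> n /HN; rewrite subr_gt0.
- by lra.
rewrite cc in HC.
exists (fun n => 1 + flip (alpha + 1) n (C n)); split.
- exact: flip_solution.
- exact: flip_periodic.
apply: cvg_of_eventually_le => e /HC[M HM]; exists M => n /HM.
by rewrite subr0 opprD addrA.
Qed.

(** The flipped sequence takes its maximum [alpha + 2] exactly at the even
multiples of [g]: elsewhere its values are [1], [alpha + 1] or
[(alpha + 1) / (alpha + 2)]. A period sends the index [0] to another maximum. *)
Lemma prime_period_solution : A + 1 = B ->
  exists y : nat -> R, is_positive_solution k l alpha A beta y /\
    has_prime_period y (2 * g)%N.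
Proof.
move=> AB; have a0 := alpha_ge0.
pose C n : R := if (g %| n)%N then alpha + 2 else 1.
have Cg : has_period C g by move=> n; rewrite /C dvdn_addl.
have C0 n : 0 < C n by rewrite /C; case: ifP => _; lra.
exists (fun n => 1 + flip (alpha + 1) n (C n)); split; first exact: flip_solution.
have g0 : (0 < g)%N by exact: odd_gt0 gcd_I_beta_odd.
split; [by rewrite muln_gt0|exact: flip_periodic|move=> q q0 qper].
have : (1 + flip (alpha + 1) q (C q)) = 1 + (alpha + 2).
  by have := qper 0%N; rewrite add0n {2}/flip /= {2}/C dvdn0.
rewrite /flip /C; case: (boolP (odd q)) => oq; case: (boolP (g %| q)%N) => gq.
- move=> h; suff : (alpha + 1) / (alpha + 2) < 1 by lra.
  by rewrite ltr_pdivrMr; lra.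
- by rewrite divr1; lra.
- move=> _; apply: dvdn_leq => //.
  by rewrite Gauss_dvd ?gq ?dvdn2 ?oq // coprime2n gcd_I_beta_odd.
- by lra.
Qed.

Lemma solution_from (init : nat -> R) : (forall n, 0 < init n) ->
  exists2 x : nat -> R, is_positive_solution k l alpha A beta x &
    forall n, (n < K)%N -> x n = init n.
Proof.
move=> i0.
pose F n (u : nat -> R) := if (n < K)%N then init n else
  (alpha + \sum_(1 <= i < k.+1) beta (2 * i)%N * u (n - 2 * i)%N + u (n - l)%N)
    / (A + u (n - l)%N).
have [|x xF] := @course_of_values R F.
  move=> n u v uv; rewrite /F; case: ltnP => // nK.
  rewrite (uv (n - l)%N); last exact: (window_lt (N := 0) nK (delay_odd k l_odd)).
  congr ((_ + _ + _) / _); apply: eq_big_nat => i ik.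
  by rewrite (uv (n - 2 * i)%N) //; exact: (window_lt (N := 0) nK (delay_even l ik)).
have xi n : (n < K)%N -> x n = init n by move=> nK; rewrite xF /F nK.
exists x => //.
have a0 := alpha_ge0; have A0 := A_ge0.
have x0 n : 0 < x n.
  elim/ltn_ind: n => n IH; rewrite xF /F; case: ltnP => // nK.
  have xl : 0 < x (n - l)%N.
    by apply: IH; apply: (window_lt (N := 0) nK (delay_odd k l_odd)).
  have xs : 0 <= \sum_(1 <= i < k.+1) beta (2 * i)%N * x (n - 2 * i)%N.
    rewrite big_nat sumr_ge0 // => i ik; rewrite mulr_ge0 ?beta_ge0 // ltW //.
    by apply: IH; apply: (window_lt (N := 0) nK (delay_even l ik)).
  by rewrite divr_gt0 //; lra.
apply: solution_of_rec => // n nK.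
rewrite {1}xF /F ltnNge nK /= divfK // gt_eqF //.
by have := x0 (n - l)%N; lra.
Qed.

(** Odd excesses stay in [0, eta] and even ones above [m], where [eta] leaves
room for [A + 1 + eta < B] and [m] is the size of the even
excesses from which the next odd excess is again at most [eta]. Then even excesses grow by the
factor [B / (A + 1 + eta)] per window: their inverses, extended by [0] at odd
indices, contract to [0]. *)
Lemma unbounded_solution : A + 1 < B ->
  exists2 x : nat -> R, is_positive_solution k l alpha A beta x & ~ bounded_fun x.
Proof.
move=> AB; have a0 := alpha_ge0; have A0 := A_ge0.
pose eta := (B - A - 1) / 2.
have eta0 : 0 < eta by rewrite /eta; lra.
have etaB : A + 1 + eta < B by rewrite /eta; lra.
pose m := (alpha + B - A + B * eta) / eta.
have Be0 : 0 <= B * eta by rewrite mulr_ge0 ?(ltW eta0) //; lra.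
have mE : m * eta = alpha + B - A + B * eta by rewrite divfK // gt_eqF.
have m0 : 0 < m by rewrite divr_gt0 //; lra.
clearbody eta m.
have [|x xs xi] := @solution_from (fun n => 1 + if odd n then eta else m).
  by move=> n; case: odd; lra.
pose y n := x n - 1.
have x0 := solution_gt0 l_odd alpha_ge0 A_ge0 beta_ge0 xs.
have T0 n : 0 < A + x (n - l)%N by rewrite ltr_wpDl.
have rec n : (K <= n)%N -> y n * (A + x (n - l)%N)
    = alpha + B - A + \sum_(1 <= i < k.+1) beta (2 * i)%N * y (n - 2 * i)%N.
  exact: excess_rec.
have grow n b : (K <= n)%N -> ~~ odd n -> 0 <= b -> y (n - l)%N <= eta ->
    (forall i, (1 <= i <= k)%N -> b <= y (n - 2 * i)%N) ->
    B * b <= y n * (A + 1 + eta).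
  move=> nK en b0 yl yb.
  have hs : B * b <= \sum_(1 <= i < k.+1) beta (2 * i)%N * y (n - 2 * i)%N.
    by rewrite BE; exact: weighted_sum_ge.
  have Bb : 0 <= B * b by rewrite mulr_ge0 //; lra.
  have hr := rec n nK.
  have yn : 0 <= y n by rewrite -(pmulr_lge0 _ (T0 n)) hr; lra.
  have : y n * (A + x (n - l)%N) <= y n * (A + 1 + eta).
    by rewrite ler_wpM2l //; move: yl; rewrite /y; lra.
  by lra.
have inv n : if odd n then 0 <= y n <= eta else m <= y n.
  elim/ltn_ind: n => n IH.
  have [nK|nK] := ltnP n K.
    rewrite /y xi //; case: odd; last by lra.
    by apply/andP; split; lra.
  have ln := window_le (N := 0) nK (delay_odd k l_odd).
  have := IH _ (window_lt (N := 0) nK (delay_odd k l_odd)); rewrite odd_sub_odd // => IHl.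
  have IHi i : (1 <= i <= k)%N ->
      if odd n then 0 <= y (n - 2 * i)%N <= eta else m <= y (n - 2 * i)%N.
    move=> ik; rewrite -(odd_sub_even (window_le (N := 0) nK (delay_even l ik))).
    exact: IH (window_lt (N := 0) nK (delay_even l ik)).
  case: (boolP (odd n)) IHl IHi => [on /= yl yi|en /= /andP[yl0 yl1] yi].
    have hs1 : \sum_(1 <= i < k.+1) beta (2 * i)%N * y (n - 2 * i)%N <= B * eta.
      by rewrite BE; apply: weighted_sum_le => // i /yi/andP[].
    have hs0 : 0 <= \sum_(1 <= i < k.+1) beta (2 * i)%N * y (n - 2 * i)%N.
      rewrite big_nat sumr_ge0 // => i ik; rewrite mulr_ge0 ?beta_ge0 //.
      by have /andP[] := yi i ik.
    have hr := rec n nK.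
    apply/andP; split; first by rewrite -(pmulr_lge0 _ (T0 n)) hr; lra.
    rewrite -(ler_pM2r (T0 n)) hr.
    have : m * eta <= (A + x (n - l)%N) * eta.
      by rewrite ler_pM2r //; move: yl; rewrite /y; lra.
    by lra.
  have Ae : 0 < A + 1 + eta by lra.
  rewrite -(ler_pM2r Ae); apply: le_trans (grow n m nK en (ltW m0) yl1 yi).
  by rewrite mulrC ler_pM2r //; lra.
exists x => // -[M [_ HM]].
have {}HM n : x n <= `|M| + 1.
  have /HM/(_ n I) : M < `|M| + 1 by rewrite ltr_pwDr // ler_norm.
  by apply: le_trans; exact: ler_norm.
pose z n := if odd n then 0 else (y n)^-1.
have t1 : (A + 1 + eta) / B < 1 by rewrite ltr_pdivrMr; lra.
have M1 : 0 < `|M| + 1 by rewrite ltr_wpDl.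
have e0 : 0 < (`|M| + 1)^-1 by rewrite invr_gt0.
have [|N HN] := @eventually_le_of_contraction R z 0 K _ _ (delay_gt0 k l_odd) e0 t1.
  move=> n W nK eW Hwin; rewrite le_max; apply/orP; right.
  have W0 : 0 < W by exact: lt_le_trans eW.
  rewrite /z; case: (boolP (odd n)) => [on|en].
    by rewrite mulr_ge0 ?(ltW W0) // divr_ge0; lra.
  have ln := window_le (N := 0) nK (delay_odd k l_odd).
  have := inv (n - l)%N; rewrite odd_sub_odd // en => /andP[_ yl].
  have yi i : (1 <= i <= k)%N -> W^-1 <= y (n - 2 * i)%N.
    move=> ik; have := Hwin _ (delay_even l ik).
    have := inv (n - 2 * i)%N.
    rewrite /z odd_sub_even ?(window_le (N := 0) nK (delay_even l ik)) // (negbTE en) => my h.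
    by rewrite -[leRHS]invrK lef_pV2 ?posrE ?invr_gt0 //; exact: lt_le_trans my.
  have Wi : 0 < W^-1 by rewrite invr_gt0.
  have := grow n _ nK en (ltW Wi) yl yi.
  have := inv n; rewrite (negbTE en) => myn.
  have yn : 0 < y n by exact: lt_le_trans myn.
  have B0 : 0 < B by lra.
  rewrite -(ler_pM2r W0) mulrAC -mulrA divff ?gt_eqF // mulr1 mulrAC => h.
  rewrite -(ler_pM2r yn) mulVf ?gt_eqF // mulrAC.
  rewrite -[_ / B * _]mulrA [_^-1 * _]mulrC mulrA mulrAC.
  by rewrite ler_pdivlMr // mul1r; lra.
have := HN (N * 2)%N; have := inv (N * 2)%N; have := HM (N * 2)%N.
rewrite /z oddM andbF => xM my /(_ (leq_pmulr _ _)).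
have yn : 0 < y (N * 2)%N by exact: lt_le_trans my.
by rewrite lef_pV2 ?posrE // => /(_ isT); rewrite /y; lra.
Qed.

End PeriodicAndUnbounded.

Theorem theorem3 (R : realType) (k l : nat) (hk : (0 < k)%N) (hl : odd l)
    (alpha A : R) (beta : nat -> R) (halpha : 0 <= alpha) (hA : 0 <= A)
    (hbeta : forall i : nat, (1 <= i <= k)%N -> 0 <= beta (2 * i)%N) :
  (* (i) *)
  (\sum_(1 <= i < k.+1) beta (2 * i)%N < A + 1 ->
    forall x : nat -> R, is_positive_solution k l alpha A beta x ->
      exists2 c : R, is_equilibrium k l alpha A beta c &
        x n @[n --> \oo] --> c) /\
  (* (ii) *)
  (A + 1 = \sum_(1 <= i < k.+1) beta (2 * i)%N ->
    (forall x : nat -> R, is_positive_solution k l alpha A beta x ->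
      exists y : nat -> R,
        [/\ is_positive_solution k l alpha A beta y,
            has_period y (2 * gcd_I_beta k l beta)%N &
            (x n - y n) @[n --> \oo] --> (0 : R)]) /\
    (exists y : nat -> R,
        is_positive_solution k l alpha A beta y /\
        has_prime_period y (2 * gcd_I_beta k l beta)%N)) /\
  (* (iii) *)
  (A + 1 < \sum_(1 <= i < k.+1) beta (2 * i)%N ->
    exists2 x : nat -> R, is_positive_solution k l alpha A beta x &
      ~ bounded_fun x).
Proof.
have BE : \sum_(1 <= i < k.+1) beta (2 * i)%N
        = \sum_(1 <= i < k.+1) beta (2 * i)%N by [].
split; [move=> AB x xs|split=> AB].
- have [above|below] := ltP A (alpha + \sum_(1 <= i < k.+1) beta (2 * i)%N).
    exact: (converges_above hl halpha hA hbeta BE xs).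
  exact: (converges_below hl halpha hA hbeta BE xs).
- split=> [x xs|].
    exact: (converges_to_periodic hl halpha hA hbeta BE AB xs).
  exact: (prime_period_solution hl halpha hA hbeta BE AB).
- exact: (unbounded_solution hl halpha hA hbeta BE AB).
Qed.
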